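(* Let $u_0$ be a deterministic function with $u_0\in\mathcal C^0_0(\overline{\mathcal D})$ and $u_0(x)\in[-1,1]$ for all $x\in\overline{\mathcal D}$, let $b,g$ satisfy the conditions (A1), (A2), (A3) given in the context, and let $\Phi$ be an integrator satisfying conditions (P0)--(P5) given in the context. Then, for any time-step size $\tau=T/M$ with $T\in(0,\infty)$ and $M\in\mathbb N$, the numerical solution $(u_m)_{0\le m\le M}$ given by the domain preserving Lie--Trotter (DPLT) splitting scheme started at $u_0$ and defined, for $m\in\{0,1,\ldots,M-1\}$ and $x\in\overline{\mathcal D}$, by $$\begin{cases}u_{m+1}(x)=\int_{\mathcal D}G_d(\tau,x,y)\,\Phi\bigl(\widetilde Z_{m+1}(y)\bigr)\,\mathrm dy,\\ \widetilde Z_{m+1}(y)=\Bigl(f(t_m,y,u_m(y))^2\tau,\ a(t_m,y,u_m(y))\tau+f(t_m,y,u_m(y))\,\delta\beta_m,\ u_m(y)\Bigr),\end{cases}$$ takes values in the domain $[-1,1]$ almost surely: $$\mathbb P\bigl(u_m(x)\in[-1,1],\ \forall m\in\{0,1,\ldots,M\},\ \forall x\in\overline{\mathcal D}\bigr)=1.$$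
   Context: $\mathbb N=\{1,2,\ldots\}$, $d\in\mathbb N$, $\mathcal D=(0,1)^d$, $\overline{\mathcal D}=[0,1]^d$, $\partial\mathcal D=\overline{\mathcal D}\setminus\mathcal D$, and $\mathcal C_0^0(\overline{\mathcal D})$ is the space of continuous functions $\overline{\mathcal D}\to\mathbb R$ vanishing on $\partial\mathcal D$. $\beta$ is a standard real-valued Brownian motion on a (filtered) probability space $(\Omega,\mathcal F,\mathbb P)$ satisfying the usual conditions. $t_m=m\tau$ and $\delta\beta_m=\beta(t_{m+1})-\beta(t_m)$. Conditions on the coefficients: $b,g:[0,\infty)\times\overline{\mathcal D}\times[-1,1]\to\mathbb R$ are continuous and (A1) $b(t,x,\pm1)=g(t,x,\pm1)=0$ for all $t\in[0,\infty)$, $x\in\overline{\mathcal D}$; (A2) for all $x\in\overline{\mathcal D}$, $u\in[-1,1]$, the maps $b(\cdot,x,u)$ and $g(\cdot,x,u)$ are H\''older continuous with exponent $\frac12$ on $[0,\infty)$, and for all $T\in(0,\infty)$ there is $C(T)\in(0,\infty)$ such that for all $s,t\in[0,T]$, $\sup_{x\in\overline{\mathcal D}}\sup_{u\in[-1,1]}\bigl(|b(t,x,u)-b(s,x,u)|+|g(t,x,u)-g(s,x,u)|\bigr)\le C(T)|t-s|^{1/2}$; (A3) for all $t,x$ the maps $b(t,x,\cdot)$ and $g(t,x,\cdot)$ are of class $\mathcal C^2$ on $[-1,1]$, the maps $\partial_u^2b,\partial_u^2g$ are continuous on $[0,\infty)\times\overline{\mathcal D}\times[-1,1]$, and for all $T\in(0,\infty)$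 there is $C(T)\in(0,\infty)$ with $\sup_{t\in[0,T]}\sup_{x\in\overline{\mathcal D}}\sup_{u\in[-1,1]}\bigl(|\partial_u^2b(t,x,u)|+|\partial_u^2g(t,x,u)|\bigr)\le C(T)$. Factorised coefficients: $\sigma(u)=(u-1)(u+1)$, and $a,f:[0,\infty)\times\overline{\mathcal D}\times[-1,1]\to\mathbb R$ are the continuous mappings such that $b(t,x,u)=a(t,x,u)\sigma(u)$ and $g(t,x,u)=f(t,x,u)\sigma(u)$ (they exist under (A1)--(A3)). Conditions on the integrator: (P0) $\Phi:[0,\infty)\times\mathbb R\times[-1,1]\to\mathbb R$, $(s,\gamma,v)\mapsto\Phi(s,\gamma,v)$, is of class $\mathcal C^3$; (P1) $\Phi(s,\gamma,v)\in[-1,1]$ for all $s\ge0,\gamma\in\mathbb R,v\in[-1,1]$; (P2) $\Phi(0,0,v)=v$ for all $v\in[-1,1]$; (P3) $\partial_\gamma\Phi(0,0,v)=\sigma(v)$ for all $v\in[-1,1]$; (P4) $\partial_s\Phi(0,0,v)+\frac12\partial_\gamma^2\Phi(0,0,v)=0$ for all $v\in[-1,1]$; (P5) there is $C\in(0,\infty)$ such that for all $s\ge0,\gamma\in\mathbb R,v\in[-1,1]$, $\sum_{\alpha_s+\alpha_\gamma+\alpha_v\le3}|\partial_s^{\alpha_s}\partial_\gamma^{\alpha_\gamma}\partial_v^{\alpha_v}\Phi(s,\gamma,v)|\le C e^{C(|\gamma|+s)}$. Heat kernel (homogeneous Dirichlet conditions): $e_k(\xi)=\sqrt2\sin(k\pi\xi)$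 for $k\in\mathbb N$, $\xi\in[0,1]$; $e_{\underline k}(x)=\prod_{j=1}^d e_{k_j}(x_j)$ for $\underline k\in\mathbb N^d$; $G_d(t,x,y)=\sum_{\underline k\in\mathbb N^d}\exp(-\|\underline k\|^2\pi^2t)\,e_{\underline k}(x)e_{\underline k}(y)$ for $t>0$, $x,y\in\overline{\mathcal D}$, with $\|\cdot\|$ the Euclidean norm. Since $a,f,\Phi$ are only defined for last argument in $[-1,1]$, the well-definedness of the recursion is part of the statement. *)

(* Defs.v *)
From HB Require Import structures.
From mathcomp Require Import all_boot all_order all_algebra.
From mathcomp Require Import all_classical all_reals all_analysis.

Set Implicit Arguments.
Unset Strict Implicit.
Unset Printing Implicit Defensive.
Import Order.TTheory GRing.Theory Num.Theory.
Import numFieldNormedType.Exports.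
Local Open Scope classical_set_scope.
Local Open Scope ring_scope.

(* Lebesgue measure on [R^n], by recursion on [n], on the product sigma-algebra carried by
    [n.-tuple R]: the image of [lebesgue_measure \x lebesgue_tuple n] under the
    measurable bijection [(a, v) |-> a :: v], starting from the Dirac mass on
    the one-point space. *)
Section lebesgue_tuple.
Context (R : realType).

Definition tuple_cons n (p : measurableTypeR R * n.-tuple (measurableTypeR R)) :
  n.+1.-tuple (measurableTypeR R) := [tuple of p.1 :: p.2].

Lemma measurable_tuple_cons n : measurable_fun setT (@tuple_cons n).
Proof. exact: measurable_cons. Qed.

Section step.
Variables (n : nat)
  (mu : {sigma_finite_measure set (n.-tuple (measurableTypeR R)) -> \bar R}).

Definition lebesgue_cons : set (n.+1.-tuple (measurableTypeR R)) -> \bar R :=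
  pushforward (lebesgue_measure \x mu)%E (@tuple_cons n).

Let lebesgue_cons0 : lebesgue_cons set0 = 0%E.
Proof. by rewrite /lebesgue_cons /pushforward preimage_set0 measure0. Qed.

Let lebesgue_cons_ge0 A : (0 <= lebesgue_cons A)%E.
Proof. exact: (measure_ge0 (lebesgue_measure \x mu)%E). Qed.

Let lebesgue_cons_sigma_additive : semi_sigma_additive lebesgue_cons.
Proof.
have mf := @measurable_tuple_cons n.
move=> F mF tF mUF; rewrite /lebesgue_cons /pushforward preimage_bigcup.
apply: measure_semi_sigma_additive.
- by move=> i; rewrite -[X in measurable X]setTI; exact: mf.
- apply/trivIsetP => /= i j _ _ ij; rewrite -preimage_setI.
  by move/trivIsetP : tF => /(_ _ _ _ _ ij) ->//; rewrite preimage_set0.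
- by rewrite -preimage_bigcup -[X in measurable X]setTI; exact: mf.
Qed.

HB.instance Definition _ := isMeasure.Build _ _ _ lebesgue_cons
  lebesgue_cons0 lebesgue_cons_ge0 lebesgue_cons_sigma_additive.

Let lebesgue_cons_sigma_finite : sigma_finite setT lebesgue_cons.
Proof.
have /sigma_finiteP[F [TF ndF Foo]] := sigma_finiteT (@lebesgue_measure R).
have /sigma_finiteP[G [TG ndG Goo]] := sigma_finiteT mu.
pose uncons (t : n.+1.-tuple (measurableTypeR R)) := (thead t, [tuple of behead t]).
have m_uncons : measurable_fun setT uncons.
  apply: measurable_fun_pair; first exact: measurable_tnth.
  exact: measurable_behead.
have mFG i : measurable (F i `*` G i).
  by apply: measurableX; [have [] := Foo i|have [] := Goo i].
exists (fun i => uncons @^-1` (F i `*` G i)).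
  apply/seteqP; split => // t _.
  have [i _ Fi] : (\bigcup_i F i) (thead t) by rewrite -TF.
  have [j _ Gj] : (\bigcup_i G i) [tuple of behead t] by rewrite -TG.
  exists (maxn i j) => //; split => /=.
  - by move: Fi; exact/subsetPset/ndF/leq_maxl.
  - by move: Gj; exact/subsetPset/ndG/leq_maxr.
move=> i; have [? ?] := Foo i; have [? ?] := Goo i; split.
  by rewrite -[X in measurable X]setTI; exact: m_uncons.
rewrite /lebesgue_cons /pushforward -comp_preimage.
have -> : uncons \o @tuple_cons n = id.
  apply/funext => -[a v]; rewrite /uncons /tuple_cons /= theadE.
  by congr pair; apply/val_inj.
by rewrite preimage_id product_measure1E// lte_mul_pinfty// ge0_fin_numE.
Qed.

HB.instance Definition _ := Measure_isSigmaFinite.Build _ _ _ lebesgue_cons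
  lebesgue_cons_sigma_finite.

End step.

Fixpoint lebesgue_tuple n :
    {sigma_finite_measure set (n.-tuple (measurableTypeR R)) -> \bar R} :=
  match n with
  | 0 => \d_ ([tuple] : 0.-tuple (measurableTypeR R))
  | n'.+1 => lebesgue_cons (lebesgue_tuple n')
  end.

Lemma lebesgue_tuple_box n (A : 'I_n -> set (measurableTypeR R)) :
  (forall i, measurable (A i)) ->
  lebesgue_tuple n [set v | forall i, A i (tnth v i)] =
  (\prod_(i < n) lebesgue_measure (A i))%E.
Proof.
elim: n A => [|n IHn] A mA.
  rewrite big_ord0 /= diracE mem_set//; by case.
rewrite big_ord_recl /= /lebesgue_cons /pushforward.
rewrite -(IHn (fun i => A (lift ord0 i)))// -product_measure1E//; last first.
  rewrite (_ : mkset _ = \bigcap_(i in [set: 'I_n])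
      ((fun v => tnth v i) @^-1` A (lift ord0 i))).
    apply: fin_bigcap_measurable => // i _.
    rewrite -[X in measurable X]setTI; exact: measurable_tnth.
  by apply/seteqP; split => v /= vA i *; apply: vA.
congr (_ _); apply/seteqP; split => -[a v] /= => [vA|[Aa vA] i].
  split=> [|i]; first exact: (vA ord0).
  by have := vA (lift ord0 i); rewrite tnthS.
by case: (unliftP ord0 i) => [j|] ->; rewrite ?tnthS//; exact: vA.
Qed.

End lebesgue_tuple.

(* Points of [R^d] are row vectors, which carry the topology of the library;
    integrals are taken over [d.-tuple R], which carries its sigma-algebra. *)
Section cube.
Context (R : realType) (d : nat).
Implicit Types (x : 'rV[R]_d) (F : 'rV[R]_d -> R).

Definition cube : set 'rV[R]_d := [set x | forall i, 0 < x ord0 i < 1].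

Definition closed_cube : set 'rV[R]_d := [set x | forall i, 0 <= x ord0 i <= 1].

Definition cube_boundary : set 'rV[R]_d := closed_cube `\` cube.

Definition vec (v : d.-tuple (measurableTypeR R)) : 'rV[R]_d :=
  \row_i tnth v i.

Definition cube_integral F : R :=
  \int[lebesgue_tuple R d]_(v in vec @^-1` cube) F (vec v).

Definition cube_integrable F : Prop :=
  (lebesgue_tuple R d).-integrable (vec @^-1` cube) (EFin \o (F \o vec)).

Definition is_C00 F : Prop :=
  {within closed_cube, continuous F} /\ forall x, cube_boundary x -> F x = 0.

End cube.

Section heat_kernel.
Context (R : realType).

(* [esum] only sums nonnegative families; a signed family is summed
   unconditionally as the difference of the sums of its positive and negative
   parts, both being finite for an absolutely summable family. *)
Definition signed_sum (I : choiceType) (S : set I) (f : I -> R) : R :=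
  fine (\esum_(i in S) ((EFin \o f)^\+ i) - \esum_(i in S) ((EFin \o f)^\- i))%E.

Variable d : nat.

Definition multi_index : set {ffun 'I_d -> nat} :=
  [set k | forall j, (0 < k j)%N].

Definition sq_norm (k : {ffun 'I_d -> nat}) : R := \sum_j (k j)%:R ^+ 2.

Definition sine_mode (k : nat) (xi : R) : R :=
  Num.sqrt 2 * sin (k%:R * pi * xi).

Definition cube_mode (k : {ffun 'I_d -> nat}) (x : 'rV[R]_d) : R :=
  \prod_j sine_mode (k j) (x ord0 j).

Definition heat_kernel (t : R) (x y : 'rV[R]_d) : R :=
  signed_sum multi_index (fun k =>
    expR (- sq_norm k * pi ^+ 2 * t) * cube_mode k x * cube_mode k y).

End heat_kernel.

Section derive_on.
Context (R : realType).
Implicit Types (D : set R) (f : R -> R).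

(* The difference quotient only uses increments [h] with [h + x] in [D], so the
   derivative is one-sided at an endpoint of an interval [D]. *)
Definition diff_quotient_filter D f (x : R) : set_system R :=
  (fun h => h^-1 * (f (h + x) - f x)) @ within [set h | D (h + x)] 0^'.

Definition derivable_on D f (x : R) : Prop := cvg (diff_quotient_filter D f x).

Definition deriv_on D f (x : R) : R := lim (diff_quotient_filter D f x).

Lemma deriv_onT f : deriv_on setT f = derive1 f.
Proof.
apply/funext => x; rewrite /deriv_on /diff_quotient_filter.
by rewrite (_ : mkset _ = setT) ?withinET//; exact/seteqP.
Qed.

Fixpoint class_C_on (k : nat) D f : Prop :=
  {within D, continuous f} /\
  match k with
  | 0 => True
  | k'.+1 => (forall x, D x -> derivable_on D f x) /\ class_C_on k' D (deriv_on D f)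
  end.

End derive_on.

Section coefficients.
Context (R : realType) (d : nat).

Definition value_range : set R := `[-1, 1].

Definition time_range : set R := `[0, +oo[.

(* Coefficients are total functions; only their values for arguments
   satisfying this predicate are constrained or meaningful. *)
Definition coef_dom : set (R * 'rV[R]_d * R) :=
  [set p | [/\ time_range p.1.1, closed_cube p.1.2 & value_range p.2]].

Definition coef_continuous (h : R -> 'rV[R]_d -> R -> R) : Prop :=
  {within coef_dom, continuous (fun p : R * 'rV[R]_d * R => h p.1.1 p.1.2 p.2)}.

Definition deriv2_u (h : R -> 'rV[R]_d -> R -> R) (t : R) (x : 'rV[R]_d) : R -> R :=
  deriv_on value_range (deriv_on value_range (h t x)).

Definition half_hoelder (f : R -> R) : Prop :=
  exists2 C : R, 0 < C & forall s t, time_range s -> time_range t ->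
    `|f t - f s| <= C * Num.sqrt `|t - s|.

Record admissible_coefs (b g : R -> 'rV[R]_d -> R -> R) : Prop := {
  coefs_continuous : coef_continuous b /\ coef_continuous g ;
  coefs_vanish : forall t x, time_range t -> closed_cube x ->
    [/\ b t x (-1) = 0, b t x 1 = 0, g t x (-1) = 0 & g t x 1 = 0] ;
  coefs_hoelder : forall x u, closed_cube x -> value_range u ->
    half_hoelder (fun t => b t x u) /\ half_hoelder (fun t => g t x u) ;
  coefs_hoelder_unif : forall T : R, 0 < T -> exists2 C : R, 0 < C &
    forall s t x u, s \in `[0, T] -> t \in `[0, T] ->
      closed_cube x -> value_range u ->
      `|b t x u - b s x u| + `|g t x u - g s x u| <= C * Num.sqrt `|t - s| ;
  coefs_C2 : forall t x, time_range t -> closed_cube x ->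
    class_C_on 2 value_range (b t x) /\ class_C_on 2 value_range (g t x) ;
  coefs_deriv2_continuous :
    coef_continuous (deriv2_u b) /\ coef_continuous (deriv2_u g) ;
  coefs_deriv2_bounded : forall T : R, 0 < T -> exists2 C : R, 0 < C &
    forall t x u, t \in `[0, T] -> closed_cube x -> value_range u ->
      `|deriv2_u b t x u| + `|deriv2_u g t x u| <= C
}.

Definition sigma (u : R) : R := (u - 1) * (u + 1).

(* The values at [u = 1] and [u = -1] are determined by continuity. *)
Definition sigma_factor (h q : R -> 'rV[R]_d -> R -> R) : Prop :=
  coef_continuous q /\
  forall t x u, coef_dom (t, x, u) -> h t x u = q t x u * sigma u.

End coefficients.

Section integrator.
Context (R : realType).
Implicit Types Phi : R -> R -> R -> R.

Definition integ_dom : set (R * R * R) :=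
  [set p | time_range p.1.1 /\ value_range p.2].

Definition d_s Phi (s gamma v : R) : R :=
  deriv_on (@time_range R) (fun s' => Phi s' gamma v) s.

Definition d_gamma Phi (s gamma v : R) : R :=
  deriv_on setT (fun gamma' => Phi s gamma' v) gamma.

Definition d_v Phi (s gamma v : R) : R :=
  deriv_on (@value_range R) (Phi s gamma) v.

(* All iterated partial derivatives of order at most [k], in every order of
   differentiation, exist and are continuous up to the boundary. *)
Fixpoint integ_class_C (k : nat) Phi : Prop :=
  {within integ_dom, continuous (fun p : R * R * R => Phi p.1.1 p.1.2 p.2)} /\
  match k with
  | 0 => True
  | k'.+1 =>
    (forall s gamma v, integ_dom (s, gamma, v) ->
      [/\ derivable_on (@time_range R) (fun s' => Phi s' gamma v) s,
          derivable_on setT (fun gamma' => Phi s gamma' v) gamma &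
          derivable_on (@value_range R) (Phi s gamma) v]) /\
    [/\ integ_class_C k' (d_s Phi), integ_class_C k' (d_gamma Phi) & integ_class_C k' (d_v Phi)]
  end.

Record integrator Phi : Prop := {
  integ_C3 : integ_class_C 3 Phi ;
  integ_range : forall s gamma v, integ_dom (s, gamma, v) ->
    value_range (Phi s gamma v) ;
  integ_id : forall v, value_range v -> Phi 0 0 v = v ;
  integ_d_gamma : forall v, value_range v -> d_gamma Phi 0 0 v = sigma v ;
  integ_generator : forall v, value_range v ->
    d_s Phi 0 0 v + 2^-1 * d_gamma (d_gamma Phi) 0 0 v = 0 ;
  integ_growth : exists2 C : R, 0 < C &
    forall s gamma v, integ_dom (s, gamma, v) ->
      \sum_(i < 4) \sum_(j < 4) \sum_(k < 4 | (i + j + k <= 3)%N)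
        `|iter i d_s (iter j d_gamma (iter k d_v Phi)) s gamma v|
      <= C * expR (C * (`|gamma| + s))
}.

End integrator.

Section brownian.
Context (R : realType) (disp : measure_display) (Omega : measurableType disp).
Variables (P : probability Omega R) (Ft : R -> set (set Omega)).

Record usual_filtration : Prop := {
  filtration_sigma_algebra : forall t : R, 0 <= t -> sigma_algebra setT (Ft t) ;
  filtration_measurable : forall t : R, 0 <= t -> Ft t `<=` measurable ;
  filtration_mono : forall s t : R, 0 <= s -> s <= t -> Ft s `<=` Ft t ;
  filtration_complete : forall N, P.-negligible N -> Ft 0 N ;
  filtration_right_cont : forall t : R, 0 <= t ->
    Ft t = \bigcap_(s in [set s | t < s]) Ft s
}.

Definition increment (beta : R -> Omega -> R) (s t : R) (w : Omega) : R :=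
  beta t w - beta s w.

Record standard_brownian (beta : R -> Omega -> R) : Prop := {
  brownian_adapted : forall t : R, 0 <= t ->
    forall B : set (measurableTypeR R), measurable B -> Ft t (beta t @^-1` B) ;
  brownian_start : {ae P, forall w, beta 0 w = 0} ;
  brownian_continuous :
    {ae P, forall w, {within @time_range R, continuous (fun t : R => beta t w)}} ;
  brownian_gaussian : forall s t : R, 0 <= s -> s < t ->
    forall B : set (measurableTypeR R), measurable B ->
      P (increment beta s t @^-1` B) =
      normal_prob 0 (Num.sqrt (t - s)) B ;
  brownian_independent : forall s t : R, 0 <= s -> s < t ->
    forall (A : set Omega) (B : set (measurableTypeR R)), Ft s A -> measurable B ->
      P (A `&` increment beta s t @^-1` B) =
      (P A * P (increment beta s t @^-1` B))%E
}.

End brownian.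

(* Pathwise scheme: [dbeta m] is the realized Brownian increment over [[m * tau, m.+1 * tau]]. *)
Section scheme.
Context (R : realType) (d : nat).
Variables (a f : R -> 'rV[R]_d -> R -> R) (Phi : R -> R -> R -> R).
Variables (tau : R) (dbeta : nat -> R).

Definition dplt_arg (m : nat) (u : 'rV[R]_d -> R) (y : 'rV[R]_d) : R * R * R :=
  let t := m%:R * tau in
  (f t y (u y) ^+ 2 * tau, a t y (u y) * tau + f t y (u y) * dbeta m, u y).

Definition dplt_integrand (m : nat) (u : 'rV[R]_d -> R) (x y : 'rV[R]_d) : R :=
  let z := dplt_arg m u y in heat_kernel tau x y * Phi z.1.1 z.1.2 z.2.

Fixpoint dplt (u0 : 'rV[R]_d -> R) (m : nat) : 'rV[R]_d -> R :=
  match m with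
  | 0 => u0
  | m'.+1 => fun x => cube_integral (dplt_integrand m' (dplt u0 m') x)
  end.

(* The step from [u] to the next iterate never evaluates [a], [f], [Phi]
   outside their domains, and its integral converges absolutely. *)
Definition dplt_step_defined (m : nat) (u : 'rV[R]_d -> R) : Prop :=
  (forall y, closed_cube y -> coef_dom (m%:R * tau, y, u y) /\
                              integ_dom (dplt_arg m u y)) /\
  (forall x, closed_cube x -> cube_integrable (dplt_integrand m u x)).

End scheme.

(* Main.v *)
Require Import Defs.
From mathcomp Require Import all_boot all_order all_algebra.
From mathcomp Require Import all_classical all_reals all_analysis.
From mathcomp Require Import measurable_realfun ring lra.
Set Implicit Arguments.
Unset Strict Implicit.
Unset Printing Implicit Defensive.
Import Order.TTheory GRing.Theory Num.Theory.
Import numFieldNormedType.Exports.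
Local Open Scope classical_set_scope.
Local Open Scope ring_scope.

(** The bound holds on every path.  One step of the scheme integrates the Dirichlet
    heat kernel against [y |-> Phi (Z y)], whose values lie in [[-1, 1]] because
    [Phi] takes its values there; hence the next iterate lies in [[-1, 1]] as soon as
    the kernel satisfies [\int `|G_d (tau, x, y)| dy <= 1] ([heat_phi_norm_le]).

    The kernel is a product over the coordinates of one-dimensional kernels
    ([heat_kernelE]), and the method of images writes the one-dimensional kernel as
    [K = (theta (pi (x - y)) - theta (pi (x + y))) / 2], where [theta] is the Jacobi
    theta function [z |-> \sum_(k in Z) exp (- c k^2) exp (i k z)] with
    [c = pi^2 tau].  Since [theta] is nonnegative ([theta_ge0]), [`|K|] is at most the
    Neumann kernel [N = (theta (pi (x - y)) + theta (pi (x + y))) / 2]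
    ([dirichlet_le_neumann]), a cosine series whose only mode of nonzero mean is the
    constant [1], so that [N] has mass [1] ([integral_neumann_kernel]).  Tonelli's
    theorem carries the bound to the cube ([integral_neumann_prod]).

    The nonnegativity of [theta] comes from its Fourier coefficients: the Gaussian
    [exp (- c (i - j)^2)] is a positive semidefinite kernel on the integers
    ([gauss_psd]), and the associated quadratic forms in exponentials are, up to
    normalisation, the Cesaro means of the partial sums of [theta]
    ([gauss_psd_theta]).

    That each step is well defined is proved by the same induction, which carries
    the continuity of the iterate along with its range.  Continuity of [u] makes
    [y |-> Phi (Z y)] continuous on the closed cube, hence measurable
    ([measurable_vec_continuous]), and the next iterate is Lipschitz because the
    heat kernel is Lipschitz in [x] uniformly in [y] ([heat_phi_lipschitz]). *)

(** * The theta function and its positivity *)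
Lemma lipschitz_bound_continuous (R : realType) (V : normedModType R)
    (f : V -> R) (L : R) :
  (forall x y, `|f x - f y| <= L * `|x - y|) -> continuous f.
Proof.
move=> fL x; apply/cvgrPdist_le => e e0.
have L0 : 0 < `|L| + 1 by rewrite ltr_wpDl.
near=> y; apply: le_trans (fL x y) _.
apply: (@le_trans _ _ ((`|L| + 1) * `|x - y|)).
  by rewrite ler_wpM2r// (le_trans (ler_norm L))// lerDl.
rewrite -ler_pdivlMl// mulrC; near: y.
by apply: cvgr_dist_le; [exact: cvg_id|rewrite divr_gt0].
Unshelve. all: by end_near. Qed.

Section theta.
Context (R : realType).
Implicit Types (c z : R) (k n : nat).

Lemma cvgn_le_bound (u : nat -> R) (l B : R) :
  u n @[n --> \oo] --> l -> (forall n, u n <= B) -> l <= B.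
Proof.
move=> ul uB; rewrite -(cvg_lim _ ul)//; apply: limr_le; last exact: nearW.
by apply/cvg_ex; exists l.
Qed.

Lemma cvgn_ge0 (u : nat -> R) (l : R) :
  u n @[n --> \oo] --> l -> (forall n, 0 <= u n) -> 0 <= l.
Proof.
move=> ul u0; rewrite -(cvg_lim _ ul)//; apply: limr_ge; last exact: nearW.
by apply/cvg_ex; exists l.
Qed.

Lemma cvg_series_bounded (w : nat -> R) (B : R) :
  (forall n, \sum_(0 <= k < n) `|w k| <= B) -> cvgn (series w).
Proof.
move=> wB; apply: normed_cvg.
apply: nondecreasing_is_cvgn.
  by apply: nondecreasing_series => k _ _; exact: normr_ge0.
by exists B => _ [n _ <-]; exact: wB.
Qed.

(** The coefficients of [theta c z], the sum of [exp (- c k^2) exp (i k z)] over all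
    integers [k]: the modes [k] and [- k] are merged into one cosine, hence the
    factor [2] for [k > 0]. *)
Definition theta_coef c k : R :=
  (if k == 0%N then 1 else 2) * expR (- (c * k%:R ^+ 2)).

Definition theta_term c z k : R := theta_coef c k * cos (k%:R * z).

Definition theta c z : R := limn (series (theta_term c z)).

Definition theta_bound c : R := 2 * (1 + 2 / c) / (1 - expR (- (c / 2))).

Lemma theta_coef_ge0 c k : 0 <= theta_coef c k.
Proof. by rewrite mulr_ge0 ?expR_ge0//; case: ifP. Qed.

(** Half of the exponent in [exp (- c k^2) <= exp (- c k)] pays for the factor
    [1 + k], the other half is a geometric series.  The factor [1 + k] makes one
    sum control both the values and the derivative of [theta]. *)
Lemma theta_coef_le c k : 0 < c ->
  theta_coef c k * (1 + k%:R) <= 2 * (1 + 2 / c) * expR (- (c / 2)) ^+ k.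
Proof.
move=> c0; rewrite -expRM_natl.
set x := (c / 2) * k%:R.
have k1 : 1 + k%:R <= (1 + 2 / c) * expR x.
  have x0 : 0 <= x by rewrite mulr_ge0// divr_ge0// ltW.
  have e1 := expR_ge1Dx x.
  have -> : k%:R = 2 / c * x :> R.
    by rewrite /x mulrA mulf_div (mulrC c) divff ?mul1r// mulf_neq0// gt_eqF.
  have : 0 <= 2 / c by rewrite divr_ge0// ltW.
  move: (2 / c) => y y0; nra.
have q1 : expR (- (c * k%:R ^+ 2)) <= expR (- x) * expR (- x).
  have xx : x + x = c * k%:R by rewrite /x -mulrDl -splitr.
  rewrite -expRD ler_expR -opprD lerN2 xx.
  rewrite ler_pM2l// -natrX ler_nat; case: k {x k1 xx} => // k.
  by rewrite expnS expn1 leq_pmulr.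
have -> : k%:R * - (c / 2) = - x by rewrite /x; ring.
apply: (@le_trans _ _ (2 * (expR (- x) * expR (- x)) * ((1 + 2 / c) * expR x))).
  apply: ler_pM k1; [exact: theta_coef_ge0|by rewrite addr_ge0|].
  apply: ler_pM q1; [by case: ifP|exact: expR_ge0|].
  by case: ifP => // _; rewrite ler1n.
rewrite le_eqVlt; apply/orP; left; apply/eqP.
have := expRxMexpNx_1 x; move: (expR x) (expR (- x)) => a b ab.
transitivity (2 * (1 + 2 / c) * b * (a * b)); last by rewrite ab mulr1.
by ring.
Qed.

Lemma theta_coef_sum_le c n : 0 < c ->
  \sum_(0 <= k < n) theta_coef c k * (1 + k%:R) <= theta_bound c.
Proof.
move=> c0; set r := expR (- (c / 2)).
have r1 : r < 1 by rewrite expR_lt1 oppr_lt0 divr_gt0.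
have r0 : 0 < r by exact: expR_gt0.
apply: le_trans (_ : series (geometric (2 * (1 + 2 / c)) r) n <= _).
  by apply: ler_sum => k _; exact: theta_coef_le.
apply: geometric_le_lim => //; last by rewrite gtr0_norm.
by rewrite mulr_ge0// addr_ge0// divr_ge0// ltW.
Qed.

Lemma theta_norm_sum_le c z n : 0 < c ->
  \sum_(0 <= k < n) `|theta_term c z k| <= theta_bound c.
Proof.
move=> c0; apply: le_trans (theta_coef_sum_le n c0); apply: ler_sum => k _.
rewrite normrM ger0_norm ?theta_coef_ge0// ler_wpM2l ?theta_coef_ge0//.
by rewrite (le_trans (cos_max _))// lerDl.
Qed.

Lemma theta_cvg c z : 0 < c ->
  series (theta_term c z) n @[n --> \oo] --> theta c z.
Proof.
move=> c0; apply: (@cvg_series_bounded _ (theta_bound c)) => n.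
exact: theta_norm_sum_le.
Qed.

Lemma theta_partial_norm_le c z n : 0 < c ->
  `|series (theta_term c z) n| <= theta_bound c.
Proof. by move=> c0; apply: le_trans (theta_norm_sum_le z n c0); exact: ler_norm_sum. Qed.

Lemma theta_norm_le c z : 0 < c -> `|theta c z| <= theta_bound c.
Proof.
move=> c0; apply: cvgn_le_bound (cvg_norm (@theta_cvg c z c0)) _ => n.
exact: theta_partial_norm_le.
Qed.

Lemma cos_lipschitz (x y : R) : `|cos x - cos y| <= `|x - y|.
Proof.
wlog xy : x y / x <= y.
  by move=> h; case: (leP x y) => [/h//|/ltW/h]; rewrite distrC [leRHS]distrC.
have dcos t : t \in `]x, y[ -> is_derive t 1 cos (- sin t).
  by move=> _; exact: is_derive_cos.
have ccos : {within `[x, y], continuous (@cos R)}.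
  by apply: continuous_subspaceT => t; exact: continuous_cos.
have [c _ e] := MVT_segment xy dcos ccos.
by rewrite distrC e normrM normrN distrC ler_piMl// sin_max.
Qed.

Lemma theta_lipschitz c z z' : 0 < c ->
  `|theta c z - theta c z'| <= theta_bound c * `|z - z'|.
Proof.
move=> c0; have /= h := cvgB (@theta_cvg c z c0) (@theta_cvg c z' c0).
pose D n := `|series (theta_term c z) n - series (theta_term c z') n|.
apply: (@cvgn_le_bound D) => [|n].
  by apply: cvg_norm; exact: h.
rewrite /D /series /= -sumrB.
apply: le_trans (ler_norm_sum _ _ _) _.
apply: le_trans (_ : \sum_(0 <= k < n) (theta_coef c k * (1 + k%:R)) * `|z - z'| <= _).
  apply: ler_sum => k _; rewrite -mulrBr normrM ger0_norm ?theta_coef_ge0//.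
  rewrite -mulrA ler_wpM2l ?theta_coef_ge0//.
  rewrite (le_trans (cos_lipschitz _ _))// -mulrBr normrM ger0_norm//.
  by rewrite ler_wpM2r// lerDr.
by rewrite -mulr_suml ler_wpM2r// theta_coef_sum_le.
Qed.

Lemma theta_continuous c : 0 < c -> continuous (theta c).
Proof.
move=> c0; apply: (@lipschitz_bound_continuous R R^o _ (theta_bound c)) => x y.
exact: theta_lipschitz.
Qed.

(** The Gaussian kernel is positive semidefinite: with [w i = exp (- c i^2)],
    [exp (- c (i - j)^2) = w i * w j * exp (2 c i j)], and expanding the last
    exponential turns the quadratic form into a nonnegative combination of squares
    [(\sum_i w i i^p cos (i z))^2 + (\sum_i w i i^p sin (i z))^2]. *)
Lemma gauss_psd c z n : 0 <= c ->
  0 <= \sum_(0 <= i < n) \sum_(0 <= j < n)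
         expR (- (c * (i%:R - j%:R) ^+ 2)) * cos ((i%:R - j%:R) * z).
Proof.
move=> c0.
pose w i : R := expR (- (c * i%:R ^+ 2)).
pose F m := \sum_(0 <= i < n) \sum_(0 <= j < n)
  w i * w j * series (exp_coeff (2 * c * i%:R * j%:R)) m * cos ((i%:R - j%:R) * z).
have Fcvg : F m @[m --> \oo] --> \sum_(0 <= i < n) \sum_(0 <= j < n)
    expR (- (c * (i%:R - j%:R) ^+ 2)) * cos ((i%:R - j%:R) * z).
  apply: cvg_big => [|i _]; first exact: add_continuous.
  apply: cvg_big => [|j _]; first exact: add_continuous.
  apply: cvgMl.
  rewrite (_ : expR _ = w i * w j * expR (2 * c * i%:R * j%:R)).
    by apply: cvgMr; exact: is_cvg_series_exp_coeff.
  by rewrite /w -!expRD; congr expR; ring.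
have F0 m : 0 <= F m.
  rewrite /F (_ : \sum_(0 <= i < n) _ = \sum_(0 <= p < m) (2 * c) ^+ p / p`!%:R *
      ((\sum_(0 <= i < n) w i * i%:R ^+ p * cos (i%:R * z)) ^+ 2 +
       (\sum_(0 <= i < n) w i * i%:R ^+ p * sin (i%:R * z)) ^+ 2)).
    apply: sumr_ge0 => p _; rewrite mulr_ge0//.
      by rewrite divr_ge0// exprn_ge0// mulr_ge0.
    by rewrite addr_ge0// sqr_ge0.
  under [RHS]eq_bigr do rewrite !expr2 !big_distrlr/= -big_split/= mulr_sumr.
  rewrite [RHS]exchange_big/=; apply: eq_bigr => i _.
  under [RHS]eq_bigr do rewrite -big_split/= mulr_sumr.
  rewrite [RHS]exchange_big/=; apply: eq_bigr => j _.
  rewrite /series/= -mulrA mulr_suml mulr_sumr; apply: eq_bigr => p _.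
  rewrite mulrBl cosB /exp_coeff/= !exprMn; ring.
exact: cvgn_ge0 Fcvg F0.
Qed.

(** Enlarging the square of indices from [n] to [n + 1] adds one row and one column,
    whose terms depend on [i - j] only and add up to a partial sum of [theta]. *)
Lemma gauss_psd_theta c z n :
  \sum_(0 <= i < n) \sum_(0 <= j < n)
     expR (- (c * (i%:R - j%:R) ^+ 2)) * cos ((i%:R - j%:R) * z) =
  series (fun m => series (theta_term c z) m.+1) n.
Proof.
pose h (x : R) := expR (- (c * x ^+ 2)) * cos (x * z).
have hN x : h (- x) = h x by rewrite /h sqrrN mulNr cosN.
elim: n => [|n IH]; first by rewrite /series/= !big_geq.
rewrite seriesSr -{}IH big_nat_recr//=.
under eq_bigr do rewrite big_nat_recr//=.
rewrite big_split/= -addrA; congr (_ + _).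
rewrite big_nat_recr//= addrA.
have e1 : \sum_(0 <= i < n) h (i%:R - n%:R) = \sum_(0 <= i < n) h (i.+1)%:R.
  rewrite big_nat_rev/= add0n; apply: eq_big_nat => i /andP[_ ni].
  rewrite -hN opprB -natrB; last by rewrite leq_subr.
  by rewrite subKn.
have e2 : \sum_(0 <= i < n) h (n%:R - i%:R) = \sum_(0 <= i < n) h (i.+1)%:R.
  by rewrite -e1; apply: eq_bigr => i _; rewrite -hN opprB.
rewrite -/(h _) -/(\sum_(0 <= i < n) _).
rewrite [X in X + _ + _]e1 [X in _ + X + _]e2.
rewrite /series/= big_nat_recl//= subrr /theta_term /theta_coef/=.
have h0 : h 0 = 1 by rewrite /h expr0n/= mulr0 oppr0 mul0r expR0 cos0 mul1r.
rewrite h0 expr0n/= mulr0 oppr0 mul0r expR0 cos0 !mulr1 addrC; congr (_ + _).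
by rewrite -big_split/=; apply: eq_bigr => i _; rewrite /h; ring.
Qed.

(** The Cesaro means of the partial sums of [theta] are the quadratic forms above,
    divided by their sizes, and they converge to [theta]. *)
Lemma theta_ge0 c z : 0 < c -> 0 <= theta c z.
Proof.
move=> c0; have h := @theta_cvg c z c0.
have {}h : series (theta_term c z) m.+1 @[m --> \oo] --> theta c z.
  by move: h; rewrite -(cvg_shiftS (series _)).
apply: cvgn_ge0 (cesaro h) _ => n; rewrite /arithmetic_mean/= mulr_ge0//.
by rewrite -gauss_psd_theta gauss_psd// ltW.
Qed.

End theta.

(** * The one-dimensional Dirichlet and Neumann heat kernels *)
Section kernels.
Context (R : realType).
Implicit Types (t x y : R) (k n : nat).

Definition heat_rate t : R := pi ^+ 2 * t.

(** Method of images: [2 sin a sin b = cos (a - b) - cos (a + b)] turns the sine series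
    of the heat kernel on [[0, 1]] into this difference of theta functions; a sum
    instead of a difference gives the kernel with Neumann conditions. *)
Definition dirichlet_kernel t x y : R :=
  (theta (heat_rate t) (pi * (x - y)) - theta (heat_rate t) (pi * (x + y))) / 2.

Definition neumann_kernel t x y : R :=
  (theta (heat_rate t) (pi * (x - y)) + theta (heat_rate t) (pi * (x + y))) / 2.

Definition sine_term t x y k : R :=
  expR (- (heat_rate t * k%:R ^+ 2)) * (sine_mode k x * sine_mode k y).

Lemma heat_rate_gt0 t : 0 < t -> 0 < heat_rate t.
Proof. by move=> t0; rewrite mulr_gt0// exprn_gt0// pi_gt0. Qed.

Lemma sine_termE t x y k :
  sine_term t x y k = (theta_term (heat_rate t) (pi * (x - y)) k -
                       theta_term (heat_rate t) (pi * (x + y)) k) / 2.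
Proof.
rewrite /sine_term /sine_mode /theta_term /theta_coef.
rewrite (_ : k%:R * (pi * (x - y)) = k%:R * pi * x - k%:R * pi * y); last by ring.
rewrite (_ : k%:R * (pi * (x + y)) = k%:R * pi * x + k%:R * pi * y); last by ring.
rewrite cosB cosD; set s := Num.sqrt 2.
have s2 : s * s = 2 by rewrite -expr2 sqr_sqrtr.
case: eqP => [->|_]; first by rewrite !mul0r sin0; field.
by rewrite [s * _ * (s * _)]mulrACA s2; field.
Qed.

Lemma series_sine_term t x y n : series (sine_term t x y) n =
  (series (theta_term (heat_rate t) (pi * (x - y))) n -
   series (theta_term (heat_rate t) (pi * (x + y))) n) / 2.
Proof.
rewrite /series/= -sumrB mulr_suml; apply: eq_bigr => k _; exact: sine_termE.
Qed.

Lemma dirichlet_kernel_cvg t x y : 0 < t ->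
  series (sine_term t x y) n @[n --> \oo] --> dirichlet_kernel t x y.
Proof.
move=> t0; have c0 := heat_rate_gt0 t0.
under eq_fun do rewrite series_sine_term.
by apply: cvgMl; apply: cvgB; exact: theta_cvg.
Qed.

Lemma sine_term_norm_sum_le t x y n : 0 < t ->
  \sum_(0 <= k < n) `|sine_term t x y k| <= theta_bound (heat_rate t).
Proof.
move=> t0; have c0 := heat_rate_gt0 t0.
have h1 := theta_norm_sum_le (pi * (x - y)) n c0.
have h2 := theta_norm_sum_le (pi * (x + y)) n c0.
apply: (@le_trans _ _ ((\sum_(0 <= k < n) `|theta_term (heat_rate t) (pi * (x - y)) k| +
  \sum_(0 <= k < n) `|theta_term (heat_rate t) (pi * (x + y)) k|) / 2)); last by lra.
rewrite -big_split/= mulr_suml; apply: ler_sum => k _.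
by rewrite sine_termE normrM [`|2^-1|]ger0_norm// ler_wpM2r// ler_normB.
Qed.

Lemma dirichlet_kernel_norm_le t x y : 0 < t ->
  `|dirichlet_kernel t x y| <= theta_bound (heat_rate t).
Proof.
move=> t0; have c0 := heat_rate_gt0 t0.
apply: (@cvgn_le_bound _ (fun n => `|series (sine_term t x y) n|)) => [|n].
  by apply: cvg_norm; exact: (@dirichlet_kernel_cvg t x y t0).
by apply: le_trans (sine_term_norm_sum_le x y n t0); exact: ler_norm_sum.
Qed.

Lemma dirichlet_kernel_sym t x y : dirichlet_kernel t x y = dirichlet_kernel t y x.
Proof.
rewrite /dirichlet_kernel (addrC x y) -(opprB y) mulrN /theta.
suff -> : theta_term (heat_rate t) (- (pi * (y - x))) =
          theta_term (heat_rate t) (pi * (y - x)) by [].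
by apply/funext => k; rewrite /theta_term mulrN cosN.
Qed.

Lemma dirichlet_kernel_lipschitz t x x' y : 0 < t ->
  `|dirichlet_kernel t x y - dirichlet_kernel t x' y| <=
  pi * theta_bound (heat_rate t) * `|x - x'|.
Proof.
move=> t0; have c0 := heat_rate_gt0 t0.
have h1 := theta_lipschitz (pi * (x - y)) (pi * (x' - y)) c0.
have h2 := theta_lipschitz (pi * (x + y)) (pi * (x' + y)) c0.
rewrite /dirichlet_kernel -mulrBl normrM [`|2^-1|]ger0_norm//.
move: h1 h2; rewrite -!mulrBr !normrM (ger0_norm (pi_ge0 R)).
rewrite (_ : x - y - (x' - y) = x - x'); last by ring.
rewrite (_ : x + y - (x' + y) = x - x'); last by ring.
set a := theta _ _; set b := theta _ _; set a' := theta _ _; set b' := theta _ _.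
rewrite mulrCA mulrA => h1 h2.
rewrite (_ : a - a' - (b - b') = (a - b) - (a' - b')); last by ring.
by have := ler_normB (a - b) (a' - b'); lra.
Qed.

(** For nonnegative numbers [a] and [b], [`|a - b| <= a + b]; here [a] and [b] are the
    values of [theta] at [pi (x - y)] and at the image point [pi (x + y)]. *)
Lemma dirichlet_le_neumann t x y : 0 < t ->
  `|dirichlet_kernel t x y| <= neumann_kernel t x y.
Proof.
move=> t0; have c0 := heat_rate_gt0 t0.
have h1 := @theta_ge0 R _ (pi * (x - y)) c0.
have h2 := @theta_ge0 R _ (pi * (x + y)) c0.
rewrite normrM [`|2^-1|]ger0_norm// ler_wpM2r//.
by rewrite (le_trans (ler_normB _ _))// !ger0_norm.
Qed.

Lemma neumann_kernel_ge0 t x y : 0 < t -> 0 <= neumann_kernel t x y.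
Proof. by move=> t0; apply: le_trans (dirichlet_le_neumann x y t0). Qed.

Definition neumann_partial t x n y : R :=
  \sum_(k < n.+1) theta_coef (heat_rate t) k * cos (k%:R * pi * x) * cos (k%:R * pi * y).

Lemma neumann_partialE t x n y : neumann_partial t x n y =
  (series (theta_term (heat_rate t) (pi * (x - y))) n.+1 +
   series (theta_term (heat_rate t) (pi * (x + y))) n.+1) / 2.
Proof.
rewrite /series/= -big_split/= mulr_suml big_mkord; apply: eq_bigr => k _.
rewrite /theta_term.
rewrite (_ : k%:R * (pi * (x - y)) = k%:R * pi * x - k%:R * pi * y); last by ring.
rewrite (_ : k%:R * (pi * (x + y)) = k%:R * pi * x + k%:R * pi * y); last by ring.
by rewrite cosB cosD; field.
Qed.

Lemma neumann_partial_cvg t x y : 0 < t ->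
  neumann_partial t x n y @[n --> \oo] --> neumann_kernel t x y.
Proof.
move=> t0; have c0 := heat_rate_gt0 t0.
under eq_fun do rewrite neumann_partialE.
by apply: cvgMl; apply: cvgD; rewrite (cvg_shiftS (series _)); exact: theta_cvg.
Qed.

Lemma neumann_partial_norm_le t x n y : 0 < t ->
  `|neumann_partial t x n y| <= theta_bound (heat_rate t).
Proof.
move=> t0; have c0 := heat_rate_gt0 t0.
have h1 := theta_partial_norm_le (pi * (x - y)) n.+1 c0.
have h2 := theta_partial_norm_le (pi * (x + y)) n.+1 c0.
rewrite neumann_partialE normrM [`|2^-1|]ger0_norm//.
set a := series _ _ in h1 *; set b := series _ _ in h2 *.
by have := ler_normD a b; lra.
Qed.

Lemma sin_natmul_pi k : sin (k%:R * pi) = 0 :> R.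
Proof.
by elim: k => [|k IH]; rewrite ?mul0r ?sin0// -natr1 mulrDl mul1r sinDpi IH oppr0.
Qed.

Lemma is_derive_sin_freq (w : R) (y : R) : w != 0 ->
  is_derive y 1 (fun y => sin (w * y) / w) (cos (w * y)).
Proof.
move=> w0; apply: is_derive_eq.
by rewrite /GRing.scale/=; field.
Qed.

Lemma neumann_partial_continuous t x n : continuous (neumann_partial t x n).
Proof.
move=> y; apply: cvg_big => [|k _]; first exact: add_continuous.
apply: cvgMr; apply: continuous_comp; last exact: continuous_cos.
exact: mulrl_continuous.
Qed.

(** Only the constant mode has a nonzero mean over [[0, 1]]. *)
Lemma integral_neumann_partial t x n :
  (\int[lebesgue_measure]_(y in `[0%R, 1%R]) (neumann_partial t x n y)%:E = 1)%E.
Proof.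
pose p k (y : R) := if k == 0%N then y else sin (k%:R * pi * y) / (k%:R * pi).
pose a k := theta_coef (heat_rate t) k * cos (k%:R * pi * x).
pose F := \sum_(k < n.+1) (fun y => a k * p k y).
have dF y : is_derive y 1 F (neumann_partial t x n y).
  apply: is_derive_sum => k; rewrite -/(a _).
  have dp : is_derive y 1 (p k) (cos (k%:R * pi * y)).
    rewrite /p; case: eqP => [->|/eqP k0].
      by rewrite !mul0r cos0; exact: is_derive_id.
    by apply: is_derive_sin_freq; rewrite mulf_neq0// ?pnatr_eq0// gt_eqF// pi_gt0.
  by apply: is_deriveZ.
have cF : continuous F.
  move=> y; apply: differentiable_continuous; apply/derivable1_diffP.
  by have [] := dF y.
rewrite (@continuous_FTC2 _ (neumann_partial t x n) F)//.
- rewrite -EFinB /F !fct_sumE -sumrB big_ord_recl big1 ?addr0.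
    by rewrite /p/= /a /theta_coef/= mulr0 subr0 expr0n/= mulr0 oppr0 expR0 !mul0r cos0 !mulr1.
  move=> k _; rewrite /p/= mulr0 sin0 mul0r mulr0 subr0 mulr1.
  suff -> : sin ((bump 0 k)%:R * pi) = 0 :> R by rewrite mul0r mulr0.
  exact: sin_natmul_pi.
- by apply: continuous_subspaceT; exact: neumann_partial_continuous.
- split.
  + by move=> y _; have [] := dF y.
  + by apply: cvg_at_right_filter; exact: cF.
  + by apply: cvg_at_left_filter; exact: cF.
- by move=> y _; rewrite derive1E; exact: derive_val.
Qed.

Lemma neumann_kernel_continuous t x : 0 < t -> continuous (neumann_kernel t x).
Proof.
move=> t0 y; have c0 := heat_rate_gt0 t0.
apply: cvgMl; apply: cvgD; apply: continuous_comp.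
- apply: cvgMr; apply: cvgB; [exact: cvg_cst|exact: cvg_id].
- exact: theta_continuous.
- apply: cvgMr; apply: cvgD; [exact: cvg_cst|exact: cvg_id].
- exact: theta_continuous.
Qed.

Lemma neumann_kernel_measurable t x : 0 < t ->
  measurable_fun setT (neumann_kernel t x).
Proof.
by move=> t0; apply: continuous_measurable_fun; exact: neumann_kernel_continuous.
Qed.

Lemma integral_neumann_kernel t x : 0 < t ->
  (\int[lebesgue_measure]_(y in `[0%R, 1%R]) (neumann_kernel t x y)%:E = 1)%E.
Proof.
move=> t0; set D : set R := `[0, 1]%classic.
have mD : measurable D by exact: measurable_itv.
have mN : measurable_fun D (EFin \o neumann_kernel t x).
  apply/measurable_EFinP; apply: measurable_funS (neumann_kernel_measurable x t0) => //.
have mP n : measurable_fun D (EFin \o neumann_partial t x n).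
  apply/measurable_EFinP; apply: (@measurable_funS _ _ _ _ setT) => //.
  by apply: continuous_measurable_fun; exact: neumann_partial_continuous.
have Pcvg : {ae lebesgue_measure, forall y, D y ->
    (neumann_partial t x n y)%:E @[n --> \oo] --> (neumann_kernel t x y)%:E}.
  apply: aeW => y _; apply/cvg_EFin; first exact: nearW.
  exact: neumann_partial_cvg.
have intB : lebesgue_measure.-integrable D (cst (theta_bound (heat_rate t))%:E).
  apply: measurable_bounded_integrable => //.
    have := lebesgue_measure_itv `[0 : R, 1].
    by rewrite /= lte_fin ltr01 -EFinB => ->; rewrite ltry.
  exact: bounded_cst.
have Ple : {ae lebesgue_measure, forall y, forall n, D y ->
    (`|(neumann_partial t x n y)%:E| <= (theta_bound (heat_rate t))%:E)%E}.
  by apply: aeW => y n _; rewrite lee_fin neumann_partial_norm_le.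
have [_ _ /=] := @dominated_convergence _ _ R lebesgue_measure D mD
  (fun n y => (neumann_partial t x n y)%:E) (fun y => (neumann_kernel t x y)%:E)
  _ mP mN Pcvg intB Ple.
under eq_fun do rewrite integral_neumann_partial.
by move=> /cvg_lim <-//; rewrite lim_cst.
Qed.

End kernels.

(** * Factorisation of the heat kernel *)
Section signed_sums.
Context (R : realType) (I : choiceType) (S : set I) (A : nat -> set I).
Hypothesis finA : forall n, finite_set (A n).
Hypothesis ndA : forall m n, (m <= n)%N -> A m `<=` A n.
Hypothesis SA : S = \bigcup_n A n.

Lemma finite_sub_exhaustion (X : set I) :
  finite_set X -> X `<=` S -> exists n, X `<=` A n.
Proof.
move=> /finite_seqP[F ->] FS.
have /choice[N FN] (i : I) : exists n, (i \in F) -> A n i.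
  case: (boolP (i \in F)) => [iF|_]; last by exists 0%N.
  by have := FS _ iF; rewrite SA => -[n _ Ani]; exists n.
exists (\max_(i <- F) N i) => i /= iF.
by apply: ndA (FN i iF); exact: leq_bigmax_seq.
Qed.

Lemma esum_exhaustion_cvg (g : I -> R) (B : R) :
  (forall i, 0 <= g i) -> (forall n, \sum_(i \in A n) g i <= B) ->
  (\esum_(i in S) (g i)%:E)%E \is a fin_num /\
  (\sum_(i \in A n) g i) @[n --> \oo] --> fine (\esum_(i in S) (g i)%:E)%E.
Proof.
move=> g0 gB; pose e n := (\sum_(i \in A n) (g i)%:E)%E.
have eE n : e n = (\sum_(i \in A n) g i)%:E by rewrite /e fsumEFin.
have e_nd : {homo e : m n / (m <= n)%N >-> (m <= n)%E}.
  move=> m n mn; apply: lee_fsum_nneg_subset => //; first exact/subsetP/ndA.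
  by move=> i _; rewrite lee_fin.
have supE : ereal_sup (range e) = (\esum_(i in S) (g i)%:E)%E.
  apply/eqP; rewrite eq_le; apply/andP; split.
    apply: ge_ereal_sup => _ [n _ <-]; apply: esum_ge; exists (A n) => //.
    by split => // i Ai; rewrite SA; exists n.
  apply: ge_ereal_sup => _ [X [finX XS] <-].
  have [n XA] := finite_sub_exhaustion finX XS.
  apply: le_trans (_ : e n <= _)%E; last by apply: ereal_sup_ubound; exists n.
  apply: lee_fsum_nneg_subset => //; first exact/subsetP.
  by move=> i _; rewrite lee_fin.
have e_cvg := ereal_nondecreasing_cvgn e_nd.
have fin : (\esum_(i in S) (g i)%:E)%E \is a fin_num.
  rewrite ge0_fin_numE ?esum_ge0//; last by move=> i _; rewrite lee_fin.
  rewrite -supE; apply: (@le_lt_trans _ _ B%:E); last exact: ltry.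
  by apply: ge_ereal_sup => _ [n _ <-]; rewrite eE lee_fin.
split => //; move: e_cvg; rewrite supE -(fineK fin) => /fine_cvg h.
by apply: cvg_trans h; apply: near_eq_cvg; apply: nearW => n /=; rewrite eE.
Qed.

(** Both the positive and the negative part of [f] have sums at most [B], so each
    converges along the exhaustion and the difference of the limits is meaningful. *)
Lemma signed_sum_cvg (f : I -> R) (B : R) :
  (forall n, \sum_(i \in A n) `|f i| <= B) ->
  (\sum_(i \in A n) f i) @[n --> \oo] --> signed_sum S f.
Proof.
move=> fB; pose p i := Num.max (f i) 0; pose q i := Num.max (- f i) 0.
have p0 i : 0 <= p i by rewrite /p le_max lexx orbT.
have q0 i : 0 <= q i by rewrite /q le_max lexx orbT.
have bound (g : I -> R) : (forall i, g i <= `|f i|) ->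
    forall n, \sum_(i \in A n) g i <= B.
  move=> gf n; apply: le_trans (fB n); rewrite !fsbig_finite//.
  by apply: ler_sum => i _; exact: gf.
have pB i : p i <= `|f i| by rewrite /p ge_max ler_norm normr_ge0.
have qB i : q i <= `|f i| by rewrite /q ge_max -normrN ler_norm normr_ge0.
have [pfin pcvg] := esum_exhaustion_cvg p0 (bound _ pB).
have [qfin qcvg] := esum_exhaustion_cvg q0 (bound _ qB).
have -> : signed_sum S f =
    fine (\esum_(i in S) (p i)%:E)%E - fine (\esum_(i in S) (q i)%:E)%E.
  rewrite -fineB//; congr fine; congr (_ - _)%E.
    by apply: eq_esum => i _; rewrite funeposE /= /p EFin_max.
  by apply: eq_esum => i _; rewrite funenegE /= /q EFin_max.
apply: cvg_trans (cvgB pcvg qcvg); apply: near_eq_cvg; apply: nearW => n /=.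
rewrite !fctE !fsbig_finite// -sumrB; apply: eq_bigr => i _.
rewrite /p /q; case: (leP (f i) 0) => fi.
  by rewrite max_l ?oppr_ge0// sub0r opprK.
by rewrite max_r ?oppr_le0 ?ltW// subr0.
Qed.

End signed_sums.

Section product_sums.
Context (R : realType) (d : nat).

Definition index_box n : set {ffun 'I_d -> nat} :=
  [set k | forall j, (0 < k j <= n)%N].

Definition shift_index n (h : {ffun 'I_d -> 'I_n}) : {ffun 'I_d -> nat} :=
  [ffun j => (h j).+1].

Lemma shift_index_bij n :
  set_bij [set: {ffun 'I_d -> 'I_n}] (index_box n) (@shift_index n).
Proof.
split.
- by move=> h _ j; rewrite ffunE ltnS leq0n ltn_ord.
- by move=> h h' _ _ /ffunP hh; apply/ffunP => j; have := hh j; rewrite !ffunE => -[/val_inj].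
- move=> k kn; have kP j : ((k j).-1 < n)%N.
    by have /andP[k0 kn'] := kn j; rewrite prednK.
  exists [ffun j => Ordinal (kP j)] => //; apply/ffunP => j; rewrite !ffunE/=.
  by have /andP[k0 _] := kn j; rewrite prednK.
Qed.

Lemma finite_index_box n : finite_set (index_box n).
Proof.
have [_ _ surj] := shift_index_bij n.
apply: sub_finite_set surj _; apply: finite_image; exact: finite_finset.
Qed.

(** Expanding the product of the partial sums enumerates the box; the terms of index
    [0] vanish, so that the boxes may avoid the coordinate hyperplanes. *)
Lemma sum_index_box n (c : 'I_d -> nat -> R) : (forall j, c j 0%N = 0) ->
  \sum_(k \in index_box n) \prod_j c j (k j) = \prod_j series (c j) n.+1.
Proof.
move=> c0; rewrite (reindex_fsbig (@shift_index n) setT)//; last exact: shift_index_bij.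
rewrite -[X in \sum_(i \in X) _](_ : [set` index_enum {ffun 'I_d -> 'I_n}] = _); last first.
  by apply/seteqP; split => // h _ /=; rewrite mem_index_enum.
rewrite -fsbig_seq ?index_enum_uniq//.
under eq_bigr do under eq_bigr do rewrite ffunE.
rewrite -(bigA_distr_bigA (fun j (i : 'I_n) => c j i.+1)); apply: eq_bigr => j _.
by rewrite /series/= big_nat_recl// c0 add0r big_mkord.
Qed.

(** The cubes of multi-indices exhaust [multi_index d], and on each cube the sum of
    products is a product of sums. *)
Lemma signed_sum_prod_cvg (c : 'I_d -> nat -> R) (B : R) :
  (forall j, c j 0%N = 0) ->
  (forall j n, \sum_(0 <= k < n) `|c j k| <= B) ->
  \prod_j series (c j) n.+1 @[n --> \oo] -->
  signed_sum (@multi_index d) (fun k => \prod_j c j (k j)).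
Proof.
move=> c0 cB.
under eq_fun do rewrite -sum_index_box//.
apply: (@signed_sum_cvg _ _ _ _ _ _ _ _ (B ^+ d)).
- exact: finite_index_box.
- by move=> m n mn k km j; have /andP[-> /leq_trans->] := km j.
- apply/seteqP; split => [k k0|k [n _ kn] j]; last by have /andP[] := kn j.
  by exists (\max_j k j) => // j; rewrite k0 leq_bigmax.
move=> n; under eq_fsbigr do rewrite normr_prod.
rewrite (@sum_index_box n (fun j k => `|c j k|)) => [|j]; last by rewrite c0 normr0.
rewrite -[in leRHS](card_ord d) -prodr_const; apply: ler_prod => j _.
by rewrite cB andbT sumr_ge0.
Qed.

End product_sums.

Section heat_kernel_factorization.
Context (R : realType) (d : nat).
Implicit Types (t : R) (x y : 'rV[R]_d).

Lemma heat_kernelE t x y : 0 < t ->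
  heat_kernel t x y = \prod_j dirichlet_kernel t (x ord0 j) (y ord0 j).
Proof.
move=> t0; pose c (j : 'I_d) := sine_term t (x ord0 j) (y ord0 j).
have -> : heat_kernel t x y = signed_sum (@multi_index d) (fun k => \prod_j c j (k j)).
  rewrite /heat_kernel; congr signed_sum; apply/funext => k.
  rewrite -mulrA /cube_mode -big_split/= /sq_norm.
  rewrite (_ : - _ * _ * _ = \sum_j - (heat_rate t * (k j)%:R ^+ 2)); last first.
    by rewrite sumrN -mulr_sumr /heat_rate; ring.
  by rewrite expR_sum -big_split.
have c0 j : c j 0%N = 0 by rewrite /c /sine_term /sine_mode !mul0r sin0 !mulr0.
have := signed_sum_prod_cvg c0 (fun j n => sine_term_norm_sum_le (x ord0 j) (y ord0 j) n t0).
move=> /cvg_lim <-//; apply/cvg_lim => //.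
apply: cvg_big => [|j _]; first exact: mul_continuous.
rewrite (cvg_shiftS (series _)); exact: dirichlet_kernel_cvg.
Qed.

End heat_kernel_factorization.

(** * Integration and measurability on the cube *)
Section tuple_integral.
Context (R : realType).

Lemma integral_lebesgue_tuple_prod n (h : 'I_n -> measurableTypeR R -> R) :
  (forall i a, 0 <= h i a) -> (forall i, measurable_fun setT (h i)) ->
  (\int[lebesgue_tuple R n]_v (\prod_(i < n) h i (tnth v i))%:E =
   \prod_(i < n) \int[lebesgue_measure]_a (h i a)%:E)%E.
Proof.
elim: n h => [|n IH] h h0 mh.
  rewrite big_ord0 /=; under eq_integral do rewrite big_ord0.
  by rewrite integral_dirac// diracT mul1e.
have mprod : measurable_fun setT
    (fun v : n.+1.-tuple (measurableTypeR R) => (\prod_(i < n.+1) h i (tnth v i))%:E).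
  apply/measurable_EFinP; apply: measurable_prod => i _.
  exact: measurableT_comp (mh i) (@measurable_tnth _ _ _ i).
have mtail : measurable_fun setT (fun v : n.-tuple (measurableTypeR R) =>
    (\prod_(i < n) h (lift ord0 i) (tnth v i))%:E).
  apply/measurable_EFinP; apply: measurable_prod => i _.
  exact: measurableT_comp (mh _) (@measurable_tnth _ _ _ i).
rewrite /= /lebesgue_cons ge0_integral_pushforward//; last 2 first.
- exact: measurable_tuple_cons.
- by move=> v _; rewrite lee_fin prodr_ge0.
rewrite preimage_setT fubini_tonelli1/=; last 2 first.
- exact: measurableT_comp mprod (@measurable_tuple_cons R n).
- by move=> p; rewrite lee_fin prodr_ge0.
rewrite big_ord_recl -IH//.
rewrite -ge0_integralZr//; last 3 first.
- by apply/measurable_EFinP; exact: mh.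
- by move=> a _; rewrite lee_fin.
- by apply: integral_ge0 => v _; rewrite lee_fin prodr_ge0.
apply: eq_integral => a _; rewrite /fubini_F -ge0_integralZl//; last 2 first.
- by move=> v _; rewrite lee_fin prodr_ge0.
- by rewrite lee_fin.
apply: eq_integral => v _; rewrite /= big_ord_recl EFinM; congr (_ * _%:E)%E.
by apply: eq_bigr => i _; rewrite tnthS.
Qed.

End tuple_integral.

Section cube_measurability.
Context (R : realType) (d : nat).

(** These countably many boxes form a base of the topology of ['rV[R]_d]; this is what
    relates open sets of row vectors to the product sigma-algebra on tuples. *)
Definition rational_box (p : {ffun 'I_d -> rat} * nat) : set 'rV[R]_d :=
  [set x | forall i, `|x ord0 i - ratr (p.1 i)| < p.2.+1%:R^-1].

Lemma measurable_vec_rational_box p : measurable (@vec R d @^-1` rational_box p).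
Proof.
rewrite (_ : _ @^-1` _ = \bigcap_(i in [set: 'I_d])
    ((fun v : d.-tuple (measurableTypeR R) => tnth v i) @^-1`
       ball (ratr (p.1 i) : R) p.2.+1%:R^-1)).
  apply: fin_bigcap_measurable => // i _.
  rewrite -[X in measurable X]setTI; apply: (measurable_tnth i) => //.
  exact: measurable_ball.
apply/seteqP; split => v vp i; have := vp i; rewrite /vec /ball/= ?mxE distrC.
  by move=> h _; exact: h.
by apply.
Qed.

Lemma open_rational_boxes (U : set 'rV[R]_d) : open U ->
  U = \bigcup_(p in [set p | rational_box p `<=` U]) rational_box p.
Proof.
move=> oU; apply/seteqP; split => [x Ux|x [p pU px]]; last exact: pU.
have /nbhs_ballP[e /= e0 eU] : nbhs x U by exact: open_nbhs_nbhs.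
have e20 : 0 < e / 2 by rewrite divr_gt0.
have [n] := ltr_add_invr e20; rewrite add0r => ne.
have n0 : 0 < n.+1%:R^-1 :> R by rewrite invr_gt0.
have /choice[q xq] (i : 'I_d) : exists q : rat, `|x ord0 i - ratr q| < n.+1%:R^-1.
  have [q] : exists q : rat, ratr q \in `]x ord0 i - n.+1%:R^-1, x ord0 i + n.+1%:R^-1[.
    by apply: rat_in_itvoo; rewrite ltrBlDr -addrA ltrDl addr_gt0.
  rewrite in_itv/= => /andP[h1 h2]; exists q.
  by rewrite distrC ltr_distl h1.
exists ([ffun i => q i], n); last by move=> i /=; rewrite ffunE.
move=> y yq; apply: eU; split => // i j; rewrite (ord1 i) /ball/=.
have := yq j; have := xq j; rewrite /= ffunE => h1 h2.
rewrite (_ : x _ _ - y _ _ = (x ord0 j - ratr (q j)) - (y ord0 j - ratr (q j))); last by ring.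
apply: le_lt_trans (ler_normB _ _) _; apply: lt_trans (ltrD h1 h2) _.
by rewrite [ltRHS]splitr ltrD.
Qed.

Lemma measurable_vec_open (U : set 'rV[R]_d) : open U -> measurable (@vec R d @^-1` U).
Proof.
move=> /open_rational_boxes ->; rewrite preimage_bigcup bigcup_mkcond.
apply: countable_bigcupT_measurable => [|p]; first exact: countableP.
by case: ifP => _ //; exact: measurable_vec_rational_box.
Qed.

Lemma open_cube : open (@cube R d).
Proof.
rewrite openE => x xc.
exists (fun _ j => `]0, 1[%classic) => [i j|y yc j].
  rewrite (ord1 i); apply: open_nbhs_nbhs; split; first exact: interval_open.
  by rewrite /= in_itv/= xc.
by have := yc ord0 j; rewrite /= in_itv.
Qed.

Lemma cube_closed_cube : @cube R d `<=` @closed_cube R d.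
Proof. by move=> x xc i; have /andP[/ltW-> /ltW->] := xc i. Qed.

Lemma measurable_cube : measurable (@vec R d @^-1` @cube R d).
Proof. by apply: measurable_vec_open; exact: open_cube. Qed.

Lemma measurable_vec_continuous (F : 'rV[R]_d -> R) :
  {within @closed_cube R d, continuous F} ->
  measurable_fun (@vec R d @^-1` @cube R d) (F \o @vec R d).
Proof.
move=> /(continuous_subspaceW cube_closed_cube).
rewrite (continuous_open_subspace _ open_cube) => cF.
apply: (measurability _ (RGenOpens.measurableE R)).
move=> _ [_ [a [b ->] <-]].
rewrite (_ : _ `&` _ = @vec R d @^-1` (@cube R d `&` F @^-1` `]a, b[%classic)); last by [].
apply: measurable_vec_open; rewrite openE => x [xc xV]; apply: filterI.
  by apply: open_nbhs_nbhs; split => //; exact: open_cube.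
by apply: (cF x (mem_set xc)); apply: open_nbhs_nbhs; split => //; exact: interval_open.
Qed.

Lemma lebesgue_cube : lebesgue_tuple R d (@vec R d @^-1` @cube R d) = 1%E.
Proof.
have mI : measurable (`]0, 1[%classic : set (measurableTypeR R)) by exact: measurable_itv.
have mu01 : lebesgue_measure (`]0, 1[%classic : set (measurableTypeR R)) = 1%E.
  by have := lebesgue_measure_itv `]0 : R, 1[; rewrite /= lte_fin ltr01 -EFinB subr0.
have := @lebesgue_tuple_box R d (fun=> `]0, 1[%classic) (fun=> mI).
rewrite big1// => <-; congr (lebesgue_tuple R d _).
by apply/seteqP; split => v vc i; have := vc i; rewrite /vec mxE /= in_itv.
Qed.

End cube_measurability.

(** * Contraction and smoothing by the heat kernel *)

(** Telescoping; [1 <= C] lets the exponent [n] absorb the missing factor. *)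
Lemma prod_dist_le (R : realType) (C : R) n (a b : 'I_n -> R) : 1 <= C ->
  (forall j, `|a j| <= C) -> (forall j, `|b j| <= C) ->
  `|\prod_j a j - \prod_j b j| <= C ^+ n * \sum_j `|a j - b j|.
Proof.
move=> C1; have C0 : 0 <= C by exact: le_trans C1.
elim: n a b => [|n IH] a b aC bC; first by rewrite !big_ord0 subrr normr0 mulr0.
rewrite !big_ord_recl.
have -> : forall a0 A b0 B : R, a0 * A - b0 * B = (a0 - b0) * A + b0 * (A - B).
  by move=> *; ring.
apply: le_trans (ler_normD _ _) _; rewrite !normrM mulrDr lerD//.
  rewrite mulrC ler_wpM2r// normr_prod.
  have aCn : \prod_(i < n) `|a (lift ord0 i)| <= C ^+ n.
    apply: le_trans (_ : \prod_(i < n) C <= _); last by rewrite prodr_const card_ord.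
    by apply: ler_prod => j _; rewrite normr_ge0 aC.
  by rewrite (le_trans aCn)// exprS ler_peMl// exprn_ge0.
by rewrite exprS -mulrA ler_pM// IH.
Qed.

Section heat_step.
Context (R : realType) (d : nat) (t : R).
Hypothesis t0 : 0 < t.
Implicit Types (x y : 'rV[R]_d) (phi : 'rV[R]_d -> R).

Local Notation mu := (lebesgue_tuple R d).
Local Notation Q := (@vec R d @^-1` @cube R d).

Lemma integral_neumann_open (s : R) :
  (\int[lebesgue_measure]_(y in `]0%R, 1%R[) (neumann_kernel t s y)%:E = 1)%E.
Proof.
rewrite -(@integral_itv_bndoo _ _ _ _ true false) ?integral_neumann_kernel//.
apply/measurable_EFinP; apply: measurable_funS (neumann_kernel_measurable s t0) => //.
Qed.

(** The indicator of the cube is a product of indicators, so that the integral splits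
    into one-dimensional ones. *)
Lemma integral_neumann_prod x :
  (\int[mu]_(v in Q) (\prod_j neumann_kernel t (x ord0 j) (tnth v j))%:E = 1)%E.
Proof.
pose I01 : set (measurableTypeR R) := `]0, 1[%classic.
pose h (j : 'I_d) (s : measurableTypeR R) := neumann_kernel t (x ord0 j) s * \1_I01 s.
have mI : measurable I01 by exact: measurable_itv.
rewrite integral_mkcond.
transitivity (\int[mu]_v (\prod_j h j (tnth v j))%:E)%E.
  apply: eq_integral => v _; rewrite patchE; case: ifPn => [|vQ].
    rewrite inE => vQ; congr _%:E; apply: eq_bigr => j _; rewrite /h indicE mem_set ?mulr1//.
    by have := vQ j; rewrite /vec mxE /I01/= in_itv.
  have [j vj] : exists j, ~ I01 (tnth v j).
    apply/existsNP => vI; move/negP: vQ; apply; rewrite inE => j.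
    by have := vI j; rewrite /I01/= in_itv/= /vec mxE.
  by rewrite (bigD1 j)//= {1}/h indicE memNset// mulr0 mul0r.
rewrite integral_lebesgue_tuple_prod.
- rewrite big1// => j _; rewrite /h -(integral_neumann_open (x ord0 j)) [RHS]integral_mkcond.
  apply: eq_integral => s _; rewrite patchE indicE /I01.
  by case: (s \in _); rewrite ?mulr1 ?mulr0.
- by move=> j s; rewrite /h mulr_ge0// neumann_kernel_ge0.
- move=> j; apply: measurable_funM; first exact: neumann_kernel_measurable.
  exact: measurable_indic.
Qed.

Lemma heat_kernel_le x y : `|heat_kernel t x y| <= \prod_j neumann_kernel t (x ord0 j) (y ord0 j).
Proof.
rewrite heat_kernelE// normr_prod; apply: ler_prod => j _.
by rewrite normr_ge0 dirichlet_le_neumann.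
Qed.

Lemma dirichlet_kernel_measurable (s : R) : measurable_fun setT (dirichlet_kernel t s).
Proof.
apply: continuous_measurable_fun.
apply: (@lipschitz_bound_continuous R R^o _ (pi * theta_bound (heat_rate t))) => y z.
rewrite (dirichlet_kernel_sym t s y) (dirichlet_kernel_sym t s z).
exact: dirichlet_kernel_lipschitz.
Qed.

Lemma heat_kernel_measurable x : measurable_fun Q (heat_kernel t x \o @vec R d).
Proof.
rewrite (_ : _ \o _ = fun v => \prod_j dirichlet_kernel t (x ord0 j) (tnth v j)).
  apply: (@measurable_funS _ _ _ _ setT) => //; apply: measurable_prod => j _.
  exact: measurableT_comp (dirichlet_kernel_measurable _) (@measurable_tnth _ _ _ j).
by apply/funext => v /=; rewrite heat_kernelE//; apply: eq_bigr => j _; rewrite /vec mxE.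
Qed.

Lemma coord_norm_le (x : 'rV[R]_d) j : `|x ord0 j| <= `|x|.
Proof.
rewrite [leRHS]mx_normrE.
exact: (le_bigmax (0 : R) (fun ij : 'I_1 * 'I_d => `|x ij.1 ij.2|) (ord0, j)).
Qed.

Lemma heat_kernel_lipschitz :
  exists L, forall x x' y, `|heat_kernel t x y - heat_kernel t x' y| <= L * `|x - x'|.
Proof.
pose B := theta_bound (heat_rate t); pose C := 1 + B.
have B0 : 0 <= B by rewrite (le_trans _ (theta_norm_le 0 (heat_rate_gt0 t0))).
have C1 : 1 <= C by rewrite lerDl.
exists (C ^+ d * (d%:R * (pi * B))) => x x' y; rewrite !heat_kernelE//.
apply: le_trans (prod_dist_le C1 _ _) _.
- by move=> j; rewrite (le_trans (dirichlet_kernel_norm_le _ _ t0))// lerDr.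
- by move=> j; rewrite (le_trans (dirichlet_kernel_norm_le _ _ t0))// lerDr.
rewrite -[leRHS]mulrA ler_wpM2l ?exprn_ge0 ?(le_trans ler01)//.
apply: (@le_trans _ _ (\sum_(j < d) pi * B * `|x - x'|)); last first.
  by rewrite sumr_const card_ord -[leLHS]mulr_natl mulrA.
apply: ler_sum => j _; apply: le_trans (dirichlet_kernel_lipschitz _ _ _ t0) _.
rewrite (ler_wpM2l (mulr_ge0 (pi_ge0 R) B0))//.
by have := coord_norm_le (x - x') j; rewrite !mxE.
Qed.

Section contraction.
Variable phi : 'rV[R]_d -> R.
Hypothesis phi_cont : {within @closed_cube R d, continuous phi}.
Hypothesis phi_le1 : forall y, closed_cube y -> `|phi y| <= 1.

Let heat_phi x y := heat_kernel t x y * phi y.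

Lemma heat_phi_measurable x : measurable_fun Q (heat_phi x \o @vec R d).
Proof.
apply: measurable_funM; first exact: heat_kernel_measurable.
exact: measurable_vec_continuous.
Qed.

(** The crux: the product of the Neumann kernels dominates the heat kernel and has
    mass [1]. *)
Lemma integral_heat_phi_le x :
  (\int[mu]_(v in Q) `|(heat_phi x (vec v))%:E| <= 1)%E.
Proof.
rewrite -(integral_neumann_prod x); apply: ge0_le_integral => //.
- exact: measurable_cube.
- apply: measurableT_comp => //; apply/measurable_EFinP; exact: heat_phi_measurable.
- apply: (@measurable_funS _ _ _ _ setT) => //.
  apply/measurable_EFinP; apply: measurable_prod => j _.
  exact: measurableT_comp (neumann_kernel_measurable _ t0) (@measurable_tnth _ _ _ j).
- move=> v vQ; rewrite lee_fin normrM.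
  apply: (@le_trans _ _ `|heat_kernel t x (vec v)|).
    by rewrite ler_piMr// phi_le1//; exact: cube_closed_cube.
  apply: le_trans (heat_kernel_le _ _) _.
  by under eq_bigr do rewrite /vec mxE.
Qed.

Lemma heat_phi_integrable x : cube_integrable (heat_phi x).
Proof.
apply/integrableP; split.
  by apply/measurable_EFinP; exact: heat_phi_measurable.
by apply: le_lt_trans (integral_heat_phi_le x) _; exact: ltry.
Qed.

Lemma heat_phi_norm_le x : `|cube_integral (heat_phi x)| <= 1.
Proof.
have fin := integrable_fin_num (@measurable_cube R d) (heat_phi_integrable x).
rewrite -lee_fin /cube_integral /Rintegral -abse_EFin fineK//.
apply: le_trans (integral_heat_phi_le x); apply: le_abse_integral.
  exact: measurable_cube.
by apply/measurable_EFinP; exact: heat_phi_measurable.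
Qed.

(** The kernel is Lipschitz in its first argument uniformly in the second one, and the
    cube has measure [1]. *)
Lemma heat_phi_lipschitz :
  exists L, forall x x',
    `|cube_integral (heat_phi x) - cube_integral (heat_phi x')| <= L * `|x - x'|.
Proof.
have [L G_lip] := heat_kernel_lipschitz.
exists L => x x'.
have intD : mu.-integrable Q
    (EFin \o (fun v => heat_phi x (vec v) - heat_phi x' (vec v))).
  have := integrableB (@measurable_cube R d) (heat_phi_integrable x) (heat_phi_integrable x').
  by apply: eq_integrable => //; exact: measurable_cube.
rewrite /cube_integral -RintegralB//; last 3 first.
- exact: measurable_cube.
- exact: heat_phi_integrable.
- exact: heat_phi_integrable.
apply: le_trans (le_normr_Rintegral (@measurable_cube R d) intD) _.
have -> : L * `|x - x'| = \int[mu]_(v in Q) (L * `|x - x'|).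
  rewrite Rintegral_cst; last exact: measurable_cube.
  by rewrite [X in fine X]lebesgue_cube mulr1.
apply: le_Rintegral.
- exact: measurable_cube.
- exact: integrable_norm intD.
- apply: measurable_bounded_integrable => //.
  + exact: measurable_cube.
  + by rewrite [ltLHS]lebesgue_cube ltry.
  + exact: bounded_cst.
move=> v vQ; rewrite /heat_phi -mulrBl normrM.
by rewrite (le_trans _ (G_lip x x' (vec v)))// ler_piMr// phi_le1//; exact: cube_closed_cube.
Qed.

Lemma heat_phi_continuous : continuous (fun x => cube_integral (heat_phi x)).
Proof. by have [L /lipschitz_bound_continuous] := heat_phi_lipschitz. Qed.

End contraction.
End heat_step.

(** * One step of the scheme *)
Section within_continuity.
Context (T U V : topologicalType) (A : set T).

Lemma within_continuous_maps (B : set U) (f : T -> U) (g : U -> V) :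
  {within A, continuous f} -> {within B, continuous g} ->
  (forall x, A x -> B (f x)) -> {within A, continuous (g \o f)}.
Proof.
move=> /subspace_continuousP cf /subspace_continuousP cg AB.
apply/subspace_continuousP => x Ax; apply: cvg_comp (cg _ (AB _ Ax)) => W BW.
have := cf x Ax _ BW; rewrite !nbhs_simpl/= /within/=.
by apply: filterS => y fyW Ay; exact: (fyW Ay (AB _ Ay)).
Qed.

Lemma within_continuous_pair (f : T -> U) (g : T -> V) :
  {within A, continuous f} -> {within A, continuous g} ->
  {within A, continuous (fun x => (f x, g x))}.
Proof.
move=> /subspace_continuousP cf /subspace_continuousP cg.
apply/subspace_continuousP => x Ax; exact: cvg_pair (cf x Ax) (cg x Ax).
Qed.

End within_continuity.

Section scheme_step.
Context (R : realType) (d : nat).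
Variables (a f : R -> 'rV[R]_d -> R -> R) (Phi : R -> R -> R -> R).
Hypotheses (ca : coef_continuous a) (cf : coef_continuous f).
Hypothesis cPhi : {within @integ_dom R, continuous (fun p : R * R * R => Phi p.1.1 p.1.2 p.2)}.
Hypothesis Phi_range : forall s gamma v,
  integ_dom (s, gamma, v) -> value_range (Phi s gamma v).
Variables (tau : R) (dbeta : nat -> R).
Hypothesis tau0 : 0 < tau.
Variables (m : nat) (u : 'rV[R]_d -> R).
Hypothesis cu : {within @closed_cube R d, continuous u}.
Hypothesis u_range : forall x, closed_cube x -> value_range (u x).

Local Notation arg := (dplt_arg a f tau dbeta m u).

Local Notation phi := (fun y => Phi (arg y).1.1 (arg y).1.2 (arg y).2).

Lemma coef_dom_step y : closed_cube y -> coef_dom (m%:R * tau, y, u y).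
Proof.
move=> yc; split => //=; last exact: u_range.
by rewrite /time_range/= in_itv/= andbT mulr_ge0// ltW.
Qed.

Lemma integ_dom_step y : closed_cube y -> integ_dom (arg y).
Proof.
move=> yc; split => /=; last exact: u_range.
by rewrite /time_range/= in_itv/= andbT mulr_ge0 ?sqr_ge0// ltW.
Qed.

Lemma coef_step_continuous (h : R -> 'rV[R]_d -> R -> R) : coef_continuous h ->
  {within @closed_cube R d, continuous (fun y => h (m%:R * tau) y (u y))}.
Proof.
move=> ch; apply: (within_continuous_maps (f := fun y => (m%:R * tau, y, u y)) _ ch).
  apply: within_continuous_pair => //; apply: within_continuous_pair.
    by apply: continuous_subspaceT; exact: cst_continuous.
  by apply: continuous_subspaceT => y; exact: cvg_id.
exact: coef_dom_step.
Qed.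

Lemma integ_step_continuous :
  {within @closed_cube R d, continuous phi}.
Proof.
apply: (within_continuous_maps (f := arg) _ cPhi); last exact: integ_dom_step.
have ca' := coef_step_continuous ca; have cf' := coef_step_continuous cf.
apply: within_continuous_pair => //; apply: within_continuous_pair.
  move=> y; apply: cvgMl; have := cvgM (cf' y) (cf' y); exact.
by move=> y; apply: cvgD; apply: cvgMl; [exact: ca'|exact: cf'].
Qed.

Lemma integ_step_le1 y : closed_cube y -> `|Phi (arg y).1.1 (arg y).1.2 (arg y).2| <= 1.
Proof.
move=> yc; have := @Phi_range (arg y).1.1 (arg y).1.2 (arg y).2.
rewrite /value_range/= in_itv/= ler_norml; apply; exact: integ_dom_step.
Qed.

Lemma dplt_step_defined_of_range : dplt_step_defined a f Phi tau dbeta m u.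
Proof.
split=> [y yc|x _]; first by split; [exact: coef_dom_step|exact: integ_dom_step].
exact: (@heat_phi_integrable R d tau tau0 phi integ_step_continuous integ_step_le1 x).
Qed.

Lemma dplt_step_range x :
  value_range (cube_integral (dplt_integrand a f Phi tau dbeta m u x)).
Proof.
rewrite /value_range/= in_itv/= -ler_norml.
exact: (@heat_phi_norm_le R d tau tau0 phi integ_step_continuous integ_step_le1 x).
Qed.

(** Continuity of the iterate is what makes the next integrand measurable. *)
Lemma dplt_step_continuous :
  continuous (fun x => cube_integral (dplt_integrand a f Phi tau dbeta m u x)).
Proof. exact: (@heat_phi_continuous R d tau tau0 phi integ_step_continuous integ_step_le1). Qed.

End scheme_step.

Theorem corollary10 (R : realType) (d : nat) (hd : (0 < d)%N)
  (disp : measure_display) (Omega : measurableType disp)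
  (P : probability Omega R) (Ft : R -> set (set Omega))
  (hFt : usual_filtration P Ft)
  (beta : R -> Omega -> R) (hbeta : standard_brownian P Ft beta)
  (b g : R -> 'rV[R]_d -> R -> R) (hbg : admissible_coefs b g)
  (a f : R -> 'rV[R]_d -> R -> R)
  (ha : sigma_factor b a) (hf : sigma_factor g f)
  (Phi : R -> R -> R -> R) (hPhi : integrator Phi)
  (u0 : 'rV[R]_d -> R) (hu0 : is_C00 u0)
  (hu0_range : forall x, closed_cube x -> u0 x \in `[-1, 1])
  (T : R) (hT : 0 < T) (M : nat) (hM : (0 < M)%N) :
  let tau := T / M%:R in
  let dbeta w m := increment beta (m%:R * tau) (m.+1%:R * tau) w in
  let u w := dplt a f Phi tau (dbeta w) u0 in
  (forall w m, (m < M)%N ->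
     dplt_step_defined a f Phi tau (dbeta w) m (u w m)) /\
  let E := [set w | forall m x, (m <= M)%N -> closed_cube x ->
                      u w m x \in `[-1, 1]] in
  measurable E /\ P E = 1%E.
Proof.
move=> tau dbeta u.
have tau0 : 0 < tau by rewrite divr_gt0// ltr0n.
have [[ca _] [cf _]] := (ha, hf).
have [cPhi _] := integ_C3 hPhi.
have Phi_range := integ_range hPhi.
have inv w m : {within @closed_cube R d, continuous (u w m)} /\
               (forall x, closed_cube x -> value_range (u w m x)).
  elim: m => [|m [cu ru]]; first by split; [exact: (hu0.1)|exact: hu0_range].
  split=> [|x _]; last exact: dplt_step_range.
  by apply: continuous_subspaceT; exact: dplt_step_continuous.
split=> [w m _|E]; first by have [cu ru] := inv w m; exact: dplt_step_defined_of_range.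
have -> : E = setT.
  by apply/seteqP; split => // w _ m x _ xc; exact: (inv w m).2.
by split; [exact: measurableT|exact: probability_setT].
Qed.
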